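(* Let $n\geq 1$ be an integer, and for $f\in L_1[0,1]$ let $$L_n(f;x):=\sum_{k=0}^{\infty}\frac{(n+k+1)(n+k+2)}{n+1}\left(\int_0^1 m_{n,k}(t)f(t)\,dt\right)m_{n,k}(x),\qquad m_{n,k}(x):=\binom{n+k}{k}(1-x)^{n+1}x^k .$$ Let $e_2(t):=t^2$. Then $x\mapsto L_n(e_2;x)$, $0<x<1$, is an elementary function.
   Context: ''Elementary function'' means: on the interval $(0,1)$ it is given by a finite expression built from constants and the variable $x$ by arithmetic operations, compositions, real powers, exponentials and logarithms. *)

(* Defs.v *)
From mathcomp Require Import all_boot all_order all_algebra.
From mathcomp Require Import all_classical all_reals all_analysis.

Set Implicit Arguments.
Unset Strict Implicit.
Unset Printing Implicit Defensive.

Import Order.TTheory GRing.Theory Num.Theory.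
Import numFieldNormedType.Exports.

Local Open Scope classical_set_scope.
Local Open Scope ring_scope.

Section elementary_functions.
Variable R : realType.

Inductive expr : Type :=
| Const of R
| Var
| Add of expr & expr
| Sub of expr & expr
| Mul of expr & expr
| Div of expr & expr
| Comp of expr & expr
| Pow of expr & R
| Exp of expr
| Log of expr.

Fixpoint eval (e : expr) (x : R) : R :=
  match e with
  | Const c => c
  | Var => x
  | Add a b => eval a x + eval b x
  | Sub a b => eval a x - eval b x
  | Mul a b => eval a x * eval b x
  | Div a b => eval a x / eval b x
  | Comp a b => eval a (eval b x)
  | Pow a r => eval a x `^ r
  | Exp a => expR (eval a x)
  | Log a => ln (eval a x)
  end.

(* [/], [powR] and [ln] are total functions with conventional values outside
   their mathematical domains; [defined e x] says that evaluating [e] at [x]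
   never uses such a value. *)
Fixpoint defined (e : expr) (x : R) : Prop :=
  match e with
  | Const _ | Var => True
  | Add a b | Sub a b | Mul a b => defined a x /\ defined b x
  | Div a b => [/\ defined a x, defined b x & eval b x != 0]
  | Comp a b => defined b x /\ defined a (eval b x)
  | Pow a r => defined a x /\ (0 < eval a x \/ (eval a x = 0 /\ 0 < r))
  | Exp a => defined a x
  | Log a => defined a x /\ 0 < eval a x
  end.

Definition elementary_on (D : set R) (f : R -> R) : Prop :=
  exists e : expr, forall x, D x -> defined e x /\ f x = eval e x.

End elementary_functions.

Section operator.
Variable R : realType.

Definition m (n k : nat) (x : R) : R :=
  'C(n + k, k)%:R * (1 - x) ^+ n.+1 * x ^+ k.

Definition L_term (n : nat) (f : R -> R) (x : R) (k : nat) : R :=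
  ((n + k + 1)%:R * (n + k + 2)%:R) / (n + 1)%:R
  * (\int[lebesgue_measure]_(t in `[0, 1]) (m n k t * f t)) * m n k x.

(* The value of [limn] is meaningful only if the series converges. *)
Definition L (n : nat) (f : R -> R) (x : R) : R :=
  limn (series (L_term n f x)).

Definition e2 (t : R) : R := t ^+ 2.

End operator.

(* Main.v *)
Require Import Defs.
From mathcomp Require Import all_boot all_order all_algebra.
From mathcomp Require Import all_classical all_reals all_analysis.
From mathcomp Require Import ring.

Set Implicit Arguments.
Unset Strict Implicit.
Unset Printing Implicit Defensive.

Import Order.TTheory GRing.Theory Num.Theory.
Import numFieldNormedType.Exports.

Local Open Scope classical_set_scope.
Local Open Scope ring_scope.

(** The Beta integral turns the k-th coefficient of L_n(e_2; x) / (1-x)^(n+1)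
    into C(n+k, k) (k+1)(k+2) / ((n+k+3)(n+k+4)), which partial fractions reduce
    to the sequences C(n+k, k) and C(n+k, k) / (k+q).  The former has generating
    function (1-x)^-(n+1).  The latter reduces, by induction on n, to
    1 / (k+q), whose generating function is obtained from that of 1 / (k+1),
    namely -ln(1-x) / x, by repeatedly dropping the leading coefficient. *)

(** * Closure properties of elementary functions *)

Section elementary_closure.
Variables (R : realType) (D : set R).
Implicit Types f g : R -> R.

Lemma eq_elementary f g :
  {in D, f =1 g} -> elementary_on D f -> elementary_on D g.
Proof.
move=> fg [e He]; exists e => x Dx; have [? ?] := He _ Dx.
by rewrite -fg// inE.
Qed.

Lemma elementary_cst c : elementary_on D (fun=> c).
Proof. by exists (Defs.Const c). Qed.

Lemma elementary_id : elementary_on D id.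
Proof. by exists (Defs.Var R). Qed.

Lemma elementaryD f g : elementary_on D f -> elementary_on D g ->
  elementary_on D (fun x => f x + g x).
Proof.
move=> [a Ha] [b Hb]; exists (Defs.Add a b) => x Dx /=.
by have [[? ->] [? ->]] := (Ha _ Dx, Hb _ Dx).
Qed.

Lemma elementaryB f g : elementary_on D f -> elementary_on D g ->
  elementary_on D (fun x => f x - g x).
Proof.
move=> [a Ha] [b Hb]; exists (Defs.Sub a b) => x Dx /=.
by have [[? ->] [? ->]] := (Ha _ Dx, Hb _ Dx).
Qed.

Lemma elementaryM f g : elementary_on D f -> elementary_on D g ->
  elementary_on D (fun x => f x * g x).
Proof.
move=> [a Ha] [b Hb]; exists (Defs.Mul a b) => x Dx /=.
by have [[? ->] [? ->]] := (Ha _ Dx, Hb _ Dx).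
Qed.

(** The nonvanishing hypothesis, like positivity in [elementary_ln], discharges the side condition
    that [defined] puts on the new node. *)
Lemma elementary_div f g : (forall x, D x -> g x != 0) ->
  elementary_on D f -> elementary_on D g -> elementary_on D (fun x => f x / g x).
Proof.
move=> g0 [a Ha] [b Hb]; exists (Defs.Div a b) => x Dx /=.
have [? fE] := Ha _ Dx; have [? gE] := Hb _ Dx.
by rewrite -fE -gE; split=> //; split=> //; exact: g0.
Qed.

Lemma elementary_ln f : (forall x, D x -> 0 < f x) ->
  elementary_on D f -> elementary_on D (fun x => ln (f x)).
Proof.
move=> f0 [a Ha]; exists (Defs.Log a) => x Dx /=.
by have [? <-] := Ha _ Dx; split=> //; split=> //; exact: f0.
Qed.

Lemma elementaryXn f n : elementary_on D f -> elementary_on D (fun x => f x ^+ n).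
Proof.
move=> ef; elim: n => [|n IHn]; first exact: elementary_cst.
by apply: eq_elementary (elementaryM ef IHn) => x _; rewrite exprS.
Qed.

End elementary_closure.

(** * Logarithmic and negative binomial series *)

Section power_series.
Variable R : realType.
Implicit Types (a b : nat -> R) (x : R).

(** The remainder vanishes at 0 and has derivative t^n / (1 - t), so the mean value theorem on
    [0, x] controls it. *)
Lemma log_series_remainder x n : 0 < x < 1 ->
  `| - ln (1 - x) - series (fun k => x ^+ k.+1 / k.+1%:R) n|
    <= geometric (x / (1 - x)) x n.
Proof.
move=> /andP[x0 x1].
pose f t := - ln (1 - t) - series (fun k => t ^+ k.+1 / k.+1%:R : R) n.
have dser m (t : R) : is_derive t 1
    (fun t => series (fun k => t ^+ k.+1 / k.+1%:R : R) m)
    (series (fun k => t ^+ k) m).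
  elim: m => [|m IH].
    rewrite /series /= big_geq//.
    by under eq_fun do rewrite big_geq//; exact: is_derive_cst.
  rewrite seriesSr; under eq_fun do rewrite seriesSr.
  apply: is_deriveD.
  (* Written as a scalar multiple of a power of [id], the term has a derivative that instance
     resolution can find. *)
  have -> : (fun t : R => t ^+ m.+1 / m.+1%:R) = m.+1%:R^-1 \*: (id ^+ m.+1).
    by apply/funext => u; rewrite fctE mulrC.
  apply: is_derive_eq => /=.
  by rewrite /GRing.scale /= mulr1 mulKf// pnatr_eq0.
(* The finite geometric sum cancels all but the tail: 1/(1-t) - (1-t^n)/(1-t) = t^n/(1-t). *)
have df (t : R) : t < 1 -> is_derive t 1 f (t ^+ n / (1 - t)).
  move=> t1; have t0 : 1 - t != 0 by rewrite subr_eq0 eq_sym lt_eqF.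
  have dln : is_derive t 1 (fun t : R => ln (1 - t)) ((1 - t)^-1 * (0 - 1)).
    apply: (@is_derive1_comp R (@ln R) (fun t => 1 - t)).
    by apply: is_derive1_ln; rewrite subr_gt0.
  apply: (is_derive_eq (is_deriveB (is_deriveN dln) (dser n t))).
  have -> : series (fun k => t ^+ k) n = (1 - t ^+ n) / (1 - t).
    by rewrite exprn_geometric geometric_seriesE ?lt_eqF//= !mul1r.
  by field.
have [c] : exists2 c, c \in `]0, x[%R & f x - f 0 = c ^+ n / (1 - c) * (x - 0).
  apply: MVT => // [t|].
    by rewrite in_itv/= => /andP[_ tx]; apply: df; exact: lt_trans x1.
  apply: derivable_within_continuous => t; rewrite in_itv/= => /andP[_ tx].
  by apply: ex_derive; apply: df; exact: le_lt_trans x1.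
rewrite in_itv/= => /andP[c0 cx].
have -> : f 0 = 0.
  rewrite /f subr0 ln1 oppr0 sub0r /series /= big1 ?oppr0// => i _.
  by rewrite expr0n mul0r.
rewrite !subr0 -/(f x) => ->.
have c1 : 0 < 1 - c by rewrite subr_gt0; exact: lt_trans x1.
rewrite ger0_norm; last first.
  by rewrite mulr_ge0 ?divr_ge0 ?exprn_ge0// ltW.
have -> : x / (1 - x) * x ^+ n = x ^+ n / (1 - x) * x by rewrite mulrAC [x * _]mulrC mulrAC.
(* Since t^n / (1 - t) is nondecreasing on [0, 1), the intermediate point c may be replaced by x. *)
rewrite ler_pM2r// ler_pM ?exprn_ge0 ?invr_ge0 ?(ltW c0) ?(ltW c1)//.
  by rewrite lerXn2r ?nnegrE ?ltW.
by rewrite lef_pV2 ?posrE ?c1 ?subr_gt0 ?x1 ?lerD2l ?lerN2 ?ltW.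
Qed.

Lemma log_series x : 0 < x < 1 ->
  series (fun k => x ^+ k.+1 / k.+1%:R) @ \oo --> - ln (1 - x).
Proof.
move=> x01; have /andP[x0 x1] := x01.
apply/subr_cvg0/norm_cvg0P => /=.
apply: (@squeeze_cvgr _ _ _ _ (fun=> 0) (geometric (x / (1 - x)) x)).
- by apply: nearW => n; rewrite normr_ge0 distrC log_series_remainder.
- exact: cvg_cst.
- by apply: cvg_geometric; rewrite ger0_norm ?ltW.
Qed.

(** By induction on n: multiplying the series for n+1 by 1 - x gives the series for n, by Pascal's
    rule. *)
Lemma negative_binomial_series n x : 0 <= x < 1 ->
  series (fun k => 'C(n + k, k)%:R * x ^+ k) @ \oo --> ((1 - x) ^+ n.+1)^-1.
Proof.
move=> /andP[x0 x1]; have x1' : 1 - x != 0 by rewrite subr_eq0 eq_sym lt_eqF.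
pose t n k := 'C(n + k, k)%:R * x ^+ k.
have t_ge0 m k : 0 <= t m k by rewrite mulr_ge0 ?exprn_ge0.
elim: n => [|n IHn].
  have -> : (fun k => 'C(0 + k, k)%:R * x ^+ k) = geometric 1 x.
    by apply/funext => k; rewrite add0n binn.
  by rewrite expr1 -div1r; apply: cvg_geometric_series; rewrite ger0_norm.
rewrite -/(t n.+1); rewrite -/(t n) in IHn.
(* For partial sums the product with 1 - x leaves one boundary term, C(n+1+N, N) x^(N+1). *)
have rec N : series (t n.+1) N.+1 * (1 - x) = series (t n) N.+1 - x * t n.+1 N.
  elim: N => [|N IHN].
    by rewrite /series /= !big_nat1 /t !addn0 !bin0 !expr0; ring.
  rewrite seriesSr mulrDl IHN [in RHS]seriesSr /t.
  have -> : 'C(n.+1 + N.+1, N.+1) = ('C(n + N.+1, N.+1) + 'C(n.+1 + N, N))%N.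
    by rewrite addSn binS addnS addSn.
  by rewrite natrD exprS; ring.
(* Convergence comes before the value, because it is what makes the boundary term vanish. The terms
   are nonnegative, and [rec] bounds the partial sums by the limit for n divided by 1 - x. *)
have cv : cvgn (series (t n.+1)).
  apply: nondecreasing_is_cvgn; first exact: nondecreasing_series.
  exists (((1 - x) ^+ n.+1)^-1 / (1 - x)) => _ [N _ <-].
  have x1p : 0 < 1 - x by rewrite subr_gt0.
  rewrite ler_pdivlMr//; apply: (@le_trans _ _ (series (t n.+1) N.+1 * (1 - x))).
    by rewrite ler_pM2r// seriesSr lerDl.
  rewrite rec -(cvg_lim _ IHn)//; apply: (@le_trans _ _ (series (t n) N.+1)).
    by rewrite gerBl mulr_ge0.
  apply: nondecreasing_cvgn_le; last by apply: cvgP IHn.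
  exact: nondecreasing_series.
rewrite -cvg_shiftS.
have -> : [sequence series (t n.+1) N.+1]_N =
    (fun N => (series (t n) N.+1 - x * t n.+1 N) / (1 - x)).
  by apply/funext => N /=; rewrite -rec mulfK.
(* The factor 0 is the limit of [t n.+1 N], the general term of a convergent series. *)
have -> : ((1 - x) ^+ n.+2)^-1 = (((1 - x) ^+ n.+1)^-1 - x * 0) / (1 - x).
  by rewrite mulr0 subr0 [in LHS]exprSr invfM mulrC.
apply: cvgMl; apply: cvgB; first by rewrite (cvg_shiftS (series (t n))).
by apply: cvgMr; exact: cvg_series_cvg_0.
Qed.

(** * Sequences with an elementary generating function *)

(** Convergence and elementarity travel together, so the closure lemmas below yield both halves of
    the theorem at once. *)
Definition elementary_gf a : Prop :=
  exists2 s : R -> R, elementary_on `]0, 1[%classic s &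
    forall x, 0 < x < 1 -> series (fun k => a k * x ^+ k) @ \oo --> s x.

Lemma elementary_gfD a b : elementary_gf a -> elementary_gf b ->
  elementary_gf (fun k => a k + b k).
Proof.
move=> [s es cs] [t et ct]; exists (fun x => s x + t x); first exact: elementaryD.
move=> x x01; have := cvgD (cs _ x01) (ct _ x01).
rewrite -seriesD; under [in X in _ -> X]eq_fun do rewrite mulrDl.
exact.
Qed.

Lemma elementary_gfZ c a : elementary_gf a -> elementary_gf (fun k => c * a k).
Proof.
move=> [s es cs]; exists (fun x => c * s x).
  by apply: elementaryM => //; exact: elementary_cst.
move=> x x01; have -> : series (fun k => c * a k * x ^+ k) =
    (fun n => c * series (fun k => a k * x ^+ k) n).
  apply/funext => n; rewrite /series /= mulr_sumr.
  by apply: eq_bigr => k _; rewrite mulrA.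
by apply: cvgMr; exact: cs.
Qed.

Lemma elementary_gf_shift a : elementary_gf a -> elementary_gf (fun k => a k.+1).
Proof.
move=> [s es cs]; exists (fun x => (s x - a 0) / x).
  apply: elementary_div => [x /=| |]; last exact: elementary_id.
    by rewrite in_itv/= => /andP[x0 _]; rewrite gt_eqF.
  by apply: elementaryB => //; exact: elementary_cst.
move=> x x01; have x0 : x != 0 by case/andP: x01 => x0 _; rewrite gt_eqF.
have := cs _ x01; rewrite -cvg_shiftS => {}cs.
have -> : series (fun k => a k.+1 * x ^+ k) =
    (fun n => (series (fun k => a k * x ^+ k) n.+1 - a 0) / x).
  apply/funext => n; rewrite /series /= big_nat_recl//= expr0 mulr1 addrC addKr.
  rewrite mulr_suml; apply: eq_bigr => k _.
  by rewrite exprSr mulrA mulfK.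
by apply: cvgMl; apply: cvgB => //; exact: cvg_cst.
Qed.

Lemma elementary_gf_binomial n : elementary_gf (fun k => 'C(n + k, k)%:R).
Proof.
exists (fun x => 1 / (1 - x) ^+ n.+1).
  apply: elementary_div => [x /=| |]; last first.
  - apply: elementaryXn; apply: elementaryB; last exact: elementary_id.
    exact: elementary_cst.
  - exact: elementary_cst.
  - rewrite in_itv/= => /andP[_ x1].
    by rewrite expf_neq0// subr_eq0 eq_sym lt_eqF.
move=> x /andP[x0 x1]; rewrite div1r.
by apply: negative_binomial_series; rewrite ltW.
Qed.

Lemma elementary_gf_inv p : elementary_gf (fun k => (k + p.+1)%:R^-1).
Proof.
elim: p => [|p [s es cs]]; last first.
  have [t et ct] := elementary_gf_shift (ex_intro2 _ _ s es cs).
  by exists t => // x /ct; under eq_fun do rewrite addSnnS.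
(* The form 0 - ln(1-x) is used because [expr] has subtraction but no negation. *)
exists (fun x => (0 - ln (1 - x)) / x).
  apply: elementary_div => [x /=| |]; last exact: elementary_id.
    by rewrite in_itv/= => /andP[x0 _]; rewrite gt_eqF.
  apply: elementaryB; first exact: elementary_cst.
  apply: elementary_ln => [x /=|].
    by rewrite in_itv/= subr_gt0 => /andP[].
  by apply: elementaryB; [exact: elementary_cst|exact: elementary_id].
move=> x x01; have x0 : x != 0 by case/andP: x01 => x0 _; rewrite gt_eqF.
have -> : series (fun k => (k + 1)%:R^-1 * x ^+ k) =
    (fun n => series (fun k => x ^+ k.+1 / k.+1%:R) n / x).
  apply/funext => n; rewrite /series /= mulr_suml; apply: eq_bigr => k _.
  by rewrite addn1 exprSr mulrAC mulfK// mulrC.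
by rewrite sub0r; apply: cvgMl; exact: log_series.
Qed.

(* (n + 1) C(n+1+k, k) / (k+q) = C(n+k, k) (1 + (n + 1 - q) / (k+q)), q = p+1. *)
Lemma elementary_gf_binomial_div n p :
  elementary_gf (fun k => 'C(n + k, k)%:R / (k + p.+1)%:R).
Proof.
elim: n => [|n IHn].
  have := elementary_gf_inv p; congr elementary_gf.
  by apply/funext => k; rewrite add0n binn mul1r.
have := elementary_gfZ (n.+1%:R^-1) (elementary_gfD (elementary_gf_binomial n)
  (elementary_gfZ (n.+1%:R - p.+1%:R) IHn)).
congr elementary_gf; apply/funext => k.
have /(congr1 (fun m => m%:R : R)) : (n.+1 * 'C(n.+1 + k, k) = (n.+1 + k) * 'C(n + k, k))%N.
  have := mul_bin_down (n.+1 + k) k.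
  by rewrite addnK addSn.
rewrite !natrM => E.
have n0 : n.+1%:R != 0 :> R by rewrite pnatr_eq0.
apply: (mulfI n0); rewrite mulVKf// [RHS]mulrA E.
have : (k + p.+1)%:R != 0 :> R by rewrite pnatr_eq0 addnS.
rewrite !natrD => ?.
by field.
Qed.

End power_series.

(** * The coefficients for [e2] and the conclusion *)

(** The integrand is C(n+k, k) t^(k+2) (1-t)^(n+1), whose integral is C(n+k, k) B(k+3, n+2) = C(n+k,
    k) (k+2)! (n+1)! / (n+k+4)!. *)
Lemma Rintegral_m_e2 (R : realType) n k :
  \int[lebesgue_measure]_(t in `[0, 1]) (m n k t * e2 t) =
  (n.+1 * k.+1 * k.+2)%:R /
    ((n + k).+1 * (n + k).+2 * (n + k).+3 * (n + k).+4)%:R :> R.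
Proof.
transitivity ('C(n + k, k)%:R * beta_fun k.+3 n.+2 : R).
  rewrite /beta_fun -Rintegral_mkcond -RintegralZl//; last first.
    exact: integrable_XMonemX.
  apply: eq_Rintegral => t _.
  by rewrite /m /e2 /XMonemX /= !exprS /unstable.onem; ring.
rewrite beta_fun_fact.
have H := bin_fact (leq_addl n k); rewrite addnK in H.
have {}H : 'C(n + k, k)%:R = (n + k)`!%:R / (k`! * n`!)%:R :> R.
  by rewrite -H natrM mulfK// pnatr_eq0 -lt0n muln_gt0 !fact_gt0.
rewrite H.
have -> : (k.+2 + n.+1).+1 = (n + k).+4 by rewrite !addSn addnS addnC.
rewrite !factS !natrM.
have f0 j : j`!%:R != 0 :> R by rewrite pnatr_eq0 -lt0n fact_gt0.
have := f0 n; have := f0 k; have := f0 (n + k)%N.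
have s0 j : j.+1%:R != 0 :> R by rewrite pnatr_eq0.
have := s0 (n + k)%N; have := s0 (n + k).+1; have := s0 (n + k).+2.
have := s0 (n + k).+3.
(* These four factors only have to be nonzero for the identity to hold, so they are abstracted
   before [field]. *)
set a1 := (n + k).+1%:R; set a2 := (n + k).+2%:R; set a3 := (n + k).+3%:R.
set a4 := (n + k).+4%:R.
clearbody a1 a2 a3 a4 => ? ? ? ? ? ? ?.
by field; do ?[apply/andP; split].
Qed.

(* Partial fractions in k of (k+1)(k+2) / ((n+k+3)(n+k+4)). *)
Lemma L_term_e2E (R : realType) n (x : R) k :
  L_term n (@e2 R) x k = (1 - x) ^+ n.+1 *
    (('C(n + k, k)%:R
      + ((n.+1 * n.+2)%:R * ('C(n + k, k)%:R / (k + n.+3)%:R)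
      + - (n.+2 * n.+3)%:R * ('C(n + k, k)%:R / (k + n.+4)%:R))) * x ^+ k).
Proof.
(* The operator's prefactor cancels n+1, n+k+1 and n+k+2 from the integral. The residues of the
   remaining fraction at k = -(n+3) and k = -(n+4) are (n+1)(n+2) and -(n+2)(n+3). *)
rewrite /L_term Rintegral_m_e2 /m.
have s0 j : j.+1%:R != 0 :> R by rewrite pnatr_eq0.
have := s0 n; have := s0 (n + k)%N; have := s0 (n + k).+1; have := s0 (n + k).+2.
have := s0 (n + k).+3.
have -> : (k + n.+3 = (n + k).+3)%N by rewrite !addnS addnC.
have -> : (k + n.+4 = (n + k).+4)%N by rewrite !addnS addnC.
rewrite !addn1 addn2 !natrM.
rewrite -!natr1 natrD => ? ? ? ? ?.
by field; do ?[apply/andP; split].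
Qed.

(** The convergence clause guarantees that [limn] in [L] is the actual sum of the series on (0,
    1). *)
Theorem mainTheorem6 (R : realType) (n : nat) (hn : (1 <= n)%N) :
  (forall x : R, `]0, 1[%classic x -> cvgn (series (L_term n (@e2 R) x))) /\
  elementary_on `]0, 1[%classic (L n (@e2 R)).
Proof.
(* The three summands follow [L_term_e2E]; the arguments [n.+2] and [n.+3] give the denominators
   k+n+3 and k+n+4, as the lemma adds one. *)
have [s es cs] := elementary_gfD (elementary_gf_binomial R n) (elementary_gfD
  (elementary_gfZ (n.+1 * n.+2)%:R (elementary_gf_binomial_div R n n.+2))
  (elementary_gfZ (- (n.+2 * n.+3)%:R) (elementary_gf_binomial_div R n n.+3))).
(* The factor (1-x)^(n+1) does not depend on k and comes out of the sum. *)
have cvL (x : R) : `]0, 1[%classic x ->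
    series (L_term n (@e2 R) x) @ \oo --> (1 - x) ^+ n.+1 * s x.
  rewrite /= in_itv/= => /cs csx.
  have -> : series (L_term n (@e2 R) x) = (fun N => (1 - x) ^+ n.+1 *
      series (fun k => ('C(n + k, k)%:R
        + ((n.+1 * n.+2)%:R * ('C(n + k, k)%:R / (k + n.+3)%:R)
        + - (n.+2 * n.+3)%:R * ('C(n + k, k)%:R / (k + n.+4)%:R))) * x ^+ k) N).
    apply/funext => N; rewrite /series /= mulr_sumr; apply: eq_bigr => k _.
    exact: L_term_e2E.
  exact: cvgMr.
split=> [x /cvL /cvgP//|].
apply: (@eq_elementary _ _ (fun x => (1 - x) ^+ n.+1 * s x)).
  by move=> x; rewrite inE => /cvL /cvg_lim <-.
apply: elementaryM => //; apply: elementaryXn.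
by apply: elementaryB; [exact: elementary_cst|exact: elementary_id].
Qed.
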